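(* Let $K_{m,n}$ denote the complete bipartite graph with classes of sizes $m$ and $n$. (a) $crx_1(K_{m,n})=4$ for $2\le m\le n$. (b)(i) $crx_2(K_{2,n})=2n$ for $n\ge 2$. (b)(ii) For $n\ge 36$, $crx_2(K_{3,n})=r$, where $r$ is the integer with $\binom{r-1}{3}<n\le\binom{r}{3}$. Consequently $crx_2(K_{3,n})=\sqrt[3]{6n}+C_n$ with $1<C_n<3$. (b)(iii) $crx_2(K_{m,n})=8$ for $m\ge 4$ and $n>7^m$. (c) Let $k\ge 2$. (i) $\lceil n/(k-1)\rceil\le crx_k(K_{k,n})\le kn$ for $n\ge k$. (ii) $crx_k(K_{m,n})\ge 4k$ for $m\ge 2k$ and $n>(k-1)(4k-1)^m$. (iii) $crx_k(K_{m,n})\le 6k$ for $3k\le m\le n$.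
   Context: An edge-coloured cycle is rainbow if its edges have distinct colours. For a graph $G$ in which any $k$ vertices lie on a common cycle, $crx_k(G)$ is the minimum number of colours in an edge-colouring of $G$ such that every set of $k$ vertices of $G$ lies in some rainbow cycle. *)

(* Defs.v *)
From mathcomp Require Import all_boot.
Set Implicit Arguments. Unset Strict Implicit. Unset Printing Implicit Defensive.

Definition Kvert (m n : nat) : finType := ('I_m + 'I_n)%type.

Definition Kadj (m n : nat) : rel (Kvert m n) :=
  fun u v => match u, v with
             | inl _, inr _ | inr _, inl _ => true
             | _, _ => false
             end.

Definition colouring (m n c : nat) := 'I_m -> 'I_n -> 'I_c.

(* Colour of the (unordered) edge uv; non-edges get the dummy value 0
   (never used: it is only applied to consecutive vertices of a cycle). *)
Definition ecol (m n c : nat) (col : colouring m n c) (u v : Kvert m n) : nat :=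
  match u, v with
  | inl i, inr j | inr j, inl i => nat_of_ord (col i j)
  | _, _ => 0
  end.

Definition is_cycle (m n : nat) (s : seq (Kvert m n)) : bool :=
  [&& 3 <= size s, uniq s & cycle (@Kadj m n) s].

Definition cyc_edges (T : Type) (s : seq T) : seq (T * T) :=
  match s with
  | [::] => [::]
  | x :: p => zip s (rcons p x)
  end.

Definition rainbow_cycle (m n c : nat) (col : colouring m n c)
    (s : seq (Kvert m n)) : bool :=
  is_cycle s && uniq [seq ecol col e.1 e.2 | e <- cyc_edges s].

Definition k_rainbow_cycle_col (k m n c : nat) (col : colouring m n c) : Prop :=
  forall S : {set Kvert m n}, #|S| = k ->
    exists s : seq (Kvert m n), rainbow_cycle col s /\ {subset S <= s}.

Definition crx_feasible (k m n c : nat) : Prop :=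
  exists col : colouring m n c, k_rainbow_cycle_col k col.

Definition crx_is (k m n r : nat) : Prop :=
  crx_feasible k m n r /\ forall c, crx_feasible k m n c -> r <= c.

(* Main.v *)
Require Import Defs.
From Stdlib Require Import Reals Lra.
From mathcomp Require Import all_boot zify.
Set Implicit Arguments. Unset Strict Implicit. Unset Printing Implicit Defensive.

(** On a rainbow cycle the colour of the edge leaving a vertex determines that
    vertex; all lower bounds follow from this and the pigeonhole principle.  If
    k right vertices have the same colour vector, their 2k neighbours on a
    rainbow cycle are distinct, so the cycle has length at least 4k.  In
    K_{3,n} the triples of colours (enlarged if necessary) at different right
    vertices are different, whence n <= C(r,3); conversely, a colouring by
    different triples works as soon as any four colours are avoided by some
    triple.  For the bound 6k, the edges to the first 3k right vertices (the
    core) are coloured by the right endpoint, with two disjoint palettes for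
    two kinds of left vertices, and the edges to the other right vertices by
    the left endpoint.  A cycle alternating between the two kinds of left
    vertices through 2k core vertices is then rainbow, and each right vertex
    outside the core is inserted in it between two left vertices of the first
    kind whose colours are not used elsewhere. *)

(** * Rainbow cycles *)

Lemma uniq_map_inj (T T' : eqType) (f : T -> T') (s : seq T) :
  uniq (map f s) -> {in s &, injective f}.
Proof.
move=> Uf x y xs ys eqf; rewrite -(nth_index x xs) -(nth_index x ys).
congr (nth x s _); apply/eqP.
rewrite -(nth_uniq (f x) _ _ Uf) ?size_map ?index_mem //.
by rewrite !(nth_map x) ?index_mem // !nth_index // eqf.
Qed.

Lemma fiber_pigeonhole (aT T : finType) (g : aT -> T) (q : nat) :
  q.-1 * #|T| < #|aT| ->
  exists (S : {set aT}) (a : T), #|S| = q /\ {in S, forall x, g x = a}.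
Proof.
move=> lt_qT; suff [a lea]: exists a, q <= #|[set x | g x == a]|.
  have /card_geqP[s [Us size_s sS]] := lea.
  exists [set x in s], a; split=> [|x]; first by rewrite cardsE (card_uniqP Us).
  by rewrite inE => /sS; rewrite inE => /eqP.
apply/existsP; apply: contraTT lt_qT; rewrite negb_exists => /forallP small.
rewrite -leqNgt -sum1_card (partition_big g predT) //= mulnC -sum_nat_const.
apply: leq_sum => a _; have := small a; rewrite -ltnNge -sum1dep_card.
by case: q {small} => // q; rewrite ltnS.
Qed.

Lemma exists_set_between (T : finType) (A B : {set T}) (q : nat) :
  A \subset B -> #|A| <= q <= #|B| ->
  exists C : {set T}, [/\ A \subset C, C \subset B & #|C| = q].
Proof.
move=> sAB /andP[leAq leqB].
have /card_geqP[t [Ut size_t tD]]: q - #|A| <= #|B :\: A|.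
  by rewrite cardsD (setIidPr sAB) leq_sub2r.
exists (A :|: [set x in t]); split; first exact: subsetUl.
  by rewrite subUset sAB; apply/subsetP=> x; rewrite inE => /tD /setDP[].
rewrite cardsU [_ :&: _](_ : _ = set0) ?cards0 ?subn0.
  by rewrite [#|[set x in t]|]cardsE (card_uniqP Ut) size_t subnKC.
apply/setP=> x; rewrite !inE; apply/negP=> /andP[xA /tD /setDP[_]].
by rewrite xA.
Qed.

Section Rainbow.
Variables (m n c : nat) (col : colouring m n c).
Implicit Types (s : seq (Kvert m n)) (x y : Kvert m n) (i : 'I_m) (j : 'I_n).

Lemma rainbow_consE x p :
  rainbow_cycle col (x :: p) =
  [&& 2 < size (x :: p), uniq (x :: p), path (@Kadj m n) x (rcons p x)
    & uniq (pairmap (ecol col) x (rcons p x))].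
Proof.
rewrite /rainbow_cycle /is_cycle -!andbA.
suff ->: [seq ecol col e.1 e.2 | e <- cyc_edges (x :: p)] =
         pairmap (ecol col) x (rcons p x) by [].
(* Only the occurrences of [x] as starting vertex are generalised; the closing vertex stays fixed
   during the induction. *)
rewrite /cyc_edges; elim: p {1 3}x => [|z p IHp] y //=.
by rewrite IHp.
Qed.

Lemma cyc_edges_next s : uniq s -> cyc_edges s = [seq (x, next s x) | x <- s].
Proof.
case: s => [//|x0 p] Us.
have sz : size (zip (x0 :: p) (rcons p x0)) = size (x0 :: p).
  by rewrite size_zip size_rcons minnn.
apply: (@eq_from_nth _ (x0, x0)); first by rewrite size_map.
move=> i; rewrite sz => ltip; rewrite (nth_map x0) // nth_zip ?size_rcons //.
(* At the last index [next] wraps around to [x0], which is both the default of [nth] and the entry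
   appended by [rcons]. *)
congr pair; rewrite next_nth mem_nth // index_uniq // nth_rcons.
move: ltip; rewrite /= ltnS leq_eqVlt => /orP[/eqP->|->] //.
by rewrite ltnn eqxx nth_default.
Qed.

Definition step_col s x := ecol col x (next s x).

Lemma rainbow_step s :
  rainbow_cycle col s = is_cycle s && uniq (map (step_col s) s).
Proof.
rewrite /rainbow_cycle; case: (boolP (is_cycle s)) => //= /and3P[_ Us _].
by rewrite cyc_edges_next // -map_comp.
Qed.

Lemma step_col_inj s : rainbow_cycle col s -> {in s &, injective (step_col s)}.
Proof. by rewrite rainbow_step => /andP[_]; apply: uniq_map_inj. Qed.

Lemma ecol_lt x y : Kadj x y -> ecol col x y < c.
Proof. by case: x y => [i|j] [i'|j'] //= _; apply: ltn_ord. Qed.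

Lemma rainbow_size s : rainbow_cycle col s -> size s <= c.
Proof.
rewrite rainbow_step => /andP[/and3P[_ Us Cs] Uc].
rewrite -(size_map (step_col s)) -(size_iota 0 c).
apply: uniq_leq_size => // _ /mapP[x xs ->].
by rewrite mem_iota /=; apply/ecol_lt/next_cycle.
Qed.

Definition left_class x := if x is inl _ then true else false.

Lemma Kadj_left x y : Kadj x y -> left_class y = ~~ left_class x.
Proof. by case: x y => [?|?] [?|?]. Qed.

Lemma left_next s x : is_cycle s -> x \in s -> left_class (next s x) = ~~ left_class x.
Proof. by case/and3P=> _ _ Cs xs; apply/Kadj_left/next_cycle. Qed.

Lemma left_prev s x : is_cycle s -> x \in s -> left_class (prev s x) = ~~ left_class x.
Proof.
case/and3P=> _ _ Cs xs; rewrite -[left_class x in RHS]negbK.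
by rewrite (Kadj_left (prev_cycle Cs xs)) !negbK.
Qed.

(** [next] permutes the vertices of the cycle and exchanges the two classes, so both occur equally
    often. *)
Lemma cycle_size_left s : is_cycle s -> size s = (count left_class s).*2.
Proof.
move=> cyc_s; have Us: uniq s by case/and3P: cyc_s.
rewrite -(count_predC left_class) -addnn; apply/eqP; rewrite eqn_add2l; apply/eqP.
have eq_next: perm_eq (map (next s) s) s.
  rewrite uniq_perm ?map_inj_uniq //; first exact: can_inj (prev_next Us).
  move=> x; apply/mapP/idP => [[y ys ->]|xs]; first by rewrite mem_next.
  by exists (prev s x); rewrite ?mem_prev ?next_prev.
rewrite -(permP eq_next) count_map; apply: eq_in_count => x xs.
by rewrite /= (left_next cyc_s xs) negbK.
Qed.

Lemma count_left_card s : uniq s ->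
  count left_class s = #|[set i | inl i \in s]|.
Proof.
move=> Us; rewrite -size_filter.
have inl_inj: injective (inl : 'I_m -> Kvert m n) by move=> ? ? [].
rewrite -(card_imset _ inl_inj) -(card_uniqP (filter_uniq _ Us)).
apply: eq_card => x; rewrite mem_filter.
apply/andP/imsetP => [[]|[i + ->]]; last by rewrite inE.
by case: x => // i _ xs; exists i; rewrite ?inE.
Qed.

Lemma count_right_card s : uniq s ->
  count (predC left_class) s = #|[set j | inr j \in s]|.
Proof.
move=> Us; rewrite -size_filter.
have inr_inj: injective (inr : 'I_n -> Kvert m n) by move=> ? ? [].
rewrite -(card_imset _ inr_inj) -(card_uniqP (filter_uniq _ Us)).
apply: eq_card => x; rewrite mem_filter.
apply/andP/imsetP => [[]|[i + ->]]; last by rewrite inE.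
by case: x => // i _ xs; exists i; rewrite ?inE.
Qed.

Lemma card_left_right s : is_cycle s ->
  #|[set i : 'I_m | inl i \in s]| = #|[set j : 'I_n | inr j \in s]|.
Proof.
move=> cyc_s; have Us: uniq s by case/and3P: cyc_s.
rewrite -count_left_card // -count_right_card //.
apply/eqP; rewrite -(eqn_add2l (count left_class s)); apply/eqP.
by rewrite addnn -cycle_size_left // count_predC.
Qed.

Lemma cycle_size_ge4 s : is_cycle s -> 4 <= size s.
Proof.
move=> cyc_s; have /and3P[] := cyc_s; rewrite cycle_size_left //.
by case: count => [|[]].
Qed.

Lemma right_nextP s j : is_cycle s -> inr j \in s ->
  exists i, [/\ next s (inr j) = inl i & inl i \in s].
Proof.
move=> cyc_s js; move: (left_next cyc_s js); rewrite -(mem_next s) in js.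
by case: next js => // i; exists i.
Qed.

Lemma right_prevP s j : is_cycle s -> inr j \in s ->
  exists i, [/\ prev s (inr j) = inl i, inl i \in s & next s (inl i) = inr j].
Proof.
move=> cyc_s js; have Us: uniq s by case/and3P: cyc_s.
move: (next_prev Us (inr j)) (left_prev cyc_s js); rewrite -(mem_prev s) in js.
by case: prev js => // i; exists i.
Qed.

Lemma left_nextP s i : is_cycle s -> inl i \in s ->
  exists j, [/\ next s (inl i) = inr j & inr j \in s].
Proof.
move=> cyc_s js; move: (left_next cyc_s js); rewrite -(mem_next s) in js.
by case: next js => // j; exists j.
Qed.

Lemma left_prevP s i : is_cycle s -> inl i \in s ->
  exists j, [/\ prev s (inl i) = inr j, inr j \in s & next s (inr j) = inl i].
Proof.
move=> cyc_s js; have Us: uniq s by case/and3P: cyc_s.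
move: (next_prev Us (inl i)) (left_prev cyc_s js); rewrite -(mem_prev s) in js.
by case: prev js => // j; exists j.
Qed.

Lemma rainbow_is_cycle s : rainbow_cycle col s -> is_cycle s.
Proof. by case/andP. Qed.

(* The edges from j and j' to their cyclic successors and predecessors are four distinct edges of the cycle. *)
Lemma rainbow_right_pair s j j' : rainbow_cycle col s ->
    inr j \in s -> inr j' \in s -> j != j' ->
  exists i1 i2 i1' i2', [/\ i1 != i2, i1' != i2' &
    uniq [:: col i1 j; col i2 j; col i1' j'; col i2' j']].
Proof.
move=> rb_s js j's neq_jj'; have cyc_s := rainbow_is_cycle rb_s.
have [i1 [nj i1s]] := right_nextP cyc_s js.
have [i1' [nj' i1s']] := right_nextP cyc_s j's.
have [i2 [_ i2s ni2]] := right_prevP cyc_s js.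
have [i2' [_ i2s' ni2']] := right_prevP cyc_s j's.
have U: uniq (map (step_col s) [:: inr j; inl i2; inr j'; inl i2']).
  rewrite map_inj_in_uniq.
    rewrite /= !inE /= !andbT orbF; apply/andP; split=> //.
    (* If [i2 = i2'], this vertex would have both [j] and [j'] as successor. *)
    apply/negP => /eqP[ii']; move: ni2'; rewrite -ii' ni2 => -[/eqP].
    exact/negP.
  have sub: {subset [:: inr j; inl i2; inr j'; inl i2'] <= s}.
    by move=> z; rewrite !inE => /or4P[]/eqP->.
  by move=> x y /sub xs /sub ys; apply: (step_col_inj rb_s).
rewrite /= /step_col nj nj' ni2 ni2' /= in U.
have {}U: uniq [:: col i1 j; col i2 j; col i1' j'; col i2' j'].
  by rewrite -(map_inj_uniq val_inj).
exists i1, i2, i1', i2'; split=> //.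
  by apply: contraTneq U => ->; rewrite /= inE eqxx.
by apply: contraTneq U => ->; rewrite /= !inE eqxx /= !andbF.
Qed.
End Rainbow.

(** * Lower bounds *)

Section LowerBounds.
Variables (m n : nat).

Lemma feasible_size (k c : nat) : 0 < k <= m + n ->
  crx_feasible k m n c -> 4 <= c.
Proof.
case/andP=> _ le_k [col rb_col].
have /card_geqP[t [Ut size_t _]]: k <= #|[set: Kvert m n]|.
  by rewrite cardsT card_sum !card_ord.
have [|s [rb_s _]] := rb_col [set x in t].
  by rewrite cardsE (card_uniqP Ut).
exact: leq_trans (cycle_size_ge4 (rainbow_is_cycle rb_s)) (rainbow_size rb_s).
Qed.

Lemma rainbow_right_set (k c : nat) (col : colouring m n c) (A : {set 'I_n}) :
  k_rainbow_cycle_col k col -> #|A| = k ->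
  exists2 s, rainbow_cycle col s & {in A, forall j, inr j \in s}.
Proof.
move=> rb_col cardA; have inr_inj: injective (inr : 'I_n -> Kvert m n).
  by move=> ? ? [].
have [|s [rb_s sub_s]] := rb_col (inr @: A); first by rewrite card_imset.
by exists s => // j jA; apply/sub_s/imset_f.
Qed.

Lemma rainbow_pair_colours (c : nat) (col : colouring m n c) (j j' : 'I_n) :
  k_rainbow_cycle_col 2 col -> j != j' ->
  exists i1 i2 i1' i2', [/\ i1 != i2, i1' != i2' &
    uniq [:: col i1 j; col i2 j; col i1' j'; col i2' j']].
Proof.
move=> rb_col neq_jj'; have card2: #|[set j; j']| = 2 by rewrite cards2 neq_jj'.
have [s rb_s in_s] := rainbow_right_set rb_col card2.
by apply: rainbow_right_pair (rb_s) _ _ _; rewrite ?in_s ?inE ?eqxx ?orbT.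
Qed.

(* A colour occurring k times at one left vertex u would give a Hamiltonian cycle of K_{k,k} leaving u through two edges of that colour. *)
Lemma feasible_Kkn (c : nat) : 0 < m -> crx_feasible m m n c -> n <= m.-1 * c.
Proof.
move=> m_gt0 [col rb_col]; rewrite leqNgt; apply/negP => lt_n.
have [|A [a [cardA colA]]] := @fiber_pigeonhole _ _ (col (Ordinal m_gt0)) m.
  by rewrite !card_ord.
have [s rb_s in_s] := rainbow_right_set rb_col cardA.
have cyc_s := rainbow_is_cycle rb_s.
have subA : A \subset [set j | inr j \in s].
  by apply/subsetP=> j /in_s; rewrite inE.
have eqlr := card_left_right cyc_s.
(* The cycle has at least [m] right vertices and equally many left ones, so it visits every left
   vertex, and its right vertices are exactly [A]. *)
have all_left: [set i | inl i \in s] = [set: 'I_m].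
  apply/eqP; rewrite eqEcard subsetT cardsT card_ord eqlr.
  by apply: leq_trans (subset_leq_card subA); rewrite cardA.
have eqA : A = [set j | inr j \in s].
  by apply/eqP; rewrite eqEcard subA -eqlr all_left cardsT card_ord cardA /=.
have i0s : inl (Ordinal m_gt0) \in s.
  by have := in_setT (Ordinal m_gt0); rewrite -all_left inE.
have [j [nj js]] := left_nextP cyc_s i0s.
have [j' [_ j's nj']] := left_prevP cyc_s i0s.
have jA : j \in A by rewrite eqA inE.
have jA' : j' \in A by rewrite eqA inE.
have : step_col col s (inl (Ordinal m_gt0)) = step_col col s (inr j').
  by rewrite /step_col nj nj' /= colA // colA.
by move/(step_col_inj rb_s i0s j's).
Qed.

(* k right vertices with the same colour vector have 2k distinct neighbours on a rainbow cycle. *)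
Lemma feasible_twins (k c : nat) : k.-1 * c ^ m < n ->
  crx_feasible k m n c -> 4 * k <= c.
Proof.
move=> lt_n [col rb_col].
have [|A [a [cardA colA]]] :=
    @fiber_pigeonhole _ _ (fun j : 'I_n => [ffun i => col i j]) k.
  by rewrite card_ffun !card_ord.
have {}colA i j j' : j \in A -> j' \in A -> col i j = col i j'.
  by move=> /colA/ffunP/(_ i) + /colA/ffunP/(_ i); rewrite !ffunE => -> ->.
have [s rb_s in_s] := rainbow_right_set rb_col cardA.
have cyc_s := rainbow_is_cycle rb_s.
have Us: uniq s by case/and3P: cyc_s.
apply: leq_trans (rainbow_size rb_s); rewrite (cycle_size_left cyc_s).
have inr_inj: injective (inr : 'I_n -> Kvert m n) by move=> ? ? [].
pose t := [seq next s (inr j) | j <- enum A] ++ [seq prev s (inr j) | j <- enum A].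
have size_t : size t = k.*2 by rewrite size_cat !size_map -cardE cardA addnn.
suff: size t <= size (filter (@left_class m n) s) by rewrite size_t size_filter; lia.
apply: uniq_leq_size.
  rewrite cat_uniq !map_inj_uniq ?enum_uniq ?andbT /=.
  (* A common value [i] would be entered from [j] and left towards [j'], along edges of equal colour
     since both lie in [A]. *)
  - apply/hasPn => _ /mapP[j' j'A ->]; apply/negP => /mapP[j jA].
    rewrite !mem_enum in jA j'A.
    have [i [nj is']] := right_nextP cyc_s (in_s _ jA).
    have [i' [pj' i's nj']] := right_prevP cyc_s (in_s _ j'A).
    rewrite nj pj' => -[eqi]; rewrite {i' is' pj'}eqi in i's nj'.
    have : step_col col s (inl i) = step_col col s (inr j).
      by rewrite /step_col nj' nj /= (colA _ _ _ jA j'A).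
    by move/(step_col_inj rb_s i's (in_s _ jA)).
  - by move=> j j' /(can_inj (next_prev Us))/inr_inj.
  - by move=> j j' /(can_inj (prev_next Us))/inr_inj.
move=> x; rewrite mem_cat mem_filter.
case/orP=> /mapP[j]; rewrite mem_enum => /in_s js ->.
  by rewrite left_next // mem_next.
by rewrite left_prev // mem_prev.
Qed.

End LowerBounds.

(** Two distinct left vertices are all of them, so [rainbow_pair_colours] speaks of all edges at two
    right vertices; hence the [2 * n] edges have distinct colours. *)
Lemma crx2_K2n_lower (n c : nat) : 2 <= n -> crx_feasible 2 2 n c -> 2 * n <= c.
Proof.
move=> n_ge2 [col rb_col].
have dich (a b d : 'I_2) : a != b -> (d == a) || (d == b).
  by rewrite -!val_eqE /=; have := ltn_ord a; have := ltn_ord b; have := ltn_ord d; lia.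
have col_neq i i' j j' : j != j' -> col i j != col i' j'.
  move=> neq_jj'.
  have [i1 [i2 [i1' [i2' [ne ne' U]]]]] := rainbow_pair_colours rb_col neq_jj'.
  move: U; rewrite /= !inE !negb_or -!andbA => /and5P[_ n1 n2 n3 /andP[n4 _]].
  by case/orP: (dich _ _ i ne) (dich _ _ i' ne') => /eqP-> /orP[]/eqP->.
have col_inj : injective (fun p : 'I_2 * 'I_n => col p.1 p.2).
  move=> [i j] [i' j'] /= /eqP; case: (eqVneq j j') => [<-|/col_neq/negPf-> //].
  case: (eqVneq i i') => [<- //|neq_ii' /eqP eqc].
  (* The two edges at [j] are compared on a cycle through some other right vertex. *)
  have [j2 neq_j]: exists j2, j != j2.
    exists (if j == 0 :> nat then Ordinal n_ge2 else Ordinal (ltnW n_ge2)).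
    by rewrite -val_eqE /=; case: ifP => [/eqP->|->].
  have [i1 [i2 [i1' [i2' [ne _ U]]]]] := rainbow_pair_colours rb_col neq_j.
  suff : col i1 j = col i2 j.
    by move/eqP; move: U; rewrite /= !inE !negb_or -!andbA => /andP[/negPf->].
  have := dich _ _ i2 neq_ii'; have := dich _ _ i1 neq_ii'.
  by move: ne => /[swap] /orP[]/eqP-> /[swap] /orP[]/eqP->; rewrite ?eqxx.
by have := leq_card _ col_inj; rewrite card_prod !card_ord.
Qed.

(* Enlarge the colour set of each right vertex to a triple: two vertices with the same triple would need two disjoint pairs inside it. *)
Lemma crx2_K3n_lower (n c : nat) : 2 <= n -> crx_feasible 2 3 n c -> n <= 'C(c, 3).
Proof.
(* This leaves room to enlarge any set of at most three colours to a triple. *)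
move=> n_ge2 feas; have c_ge4 : 4 <= c.
  by apply: feasible_size feas; rewrite /= addSn ltnS addSn.
case: feas => col rb_col.
have exT j : exists T : {set 'I_c}, (#|T| == 3) && [forall i, col i j \in T].
  pose S := [set col i j | i : 'I_3].
  have leS : #|S| <= 3 by rewrite (leq_trans (leq_imset_card _ _)) // cardT size_enum_ord.
  have [T [sST _ cT]] : exists T : {set 'I_c}, [/\ S \subset T, T \subset setT & #|T| = 3].
    by apply: exists_set_between; rewrite ?subsetT ?leS ?cardsT ?card_ord ?(ltnW c_ge4).
  exists T; rewrite cT eqxx; apply/forallP => i.
  by apply: (subsetP sST); apply: imset_f.
pose T j := xchoose (exT j).
have cardT j : #|T j| = 3 by have /andP[/eqP] := xchooseP (exT j).
have colT i j : col i j \in T j.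
  by have /andP[_ /forallP] := xchooseP (exT j).
have T_inj : injective T.
  move=> j j' eqT; apply/eqP/negPn/negP => neq_jj'.
  have [i1 [i2 [i1' [i2' [_ _ U]]]]] := rainbow_pair_colours rb_col neq_jj'.
  suff: 4 <= #|T j| by rewrite cardT.
  rewrite cardE; apply: (uniq_leq_size U) => a; rewrite mem_enum !inE.
  by case/or4P=> /eqP-> //; rewrite eqT.
rewrite -[n in n <= _]card_ord -cardsT -(card_imset _ T_inj).
rewrite -[c in 'C(c, 3)]card_ord -card_draws.
by apply/subset_leq_card/subsetP => _ /imsetP[j _ ->]; rewrite inE cardT.
Qed.

(** * Colourings for one and two vertices *)

Lemma colouring_of_nat (m n c : nat) (f : nat -> nat -> nat) :
  (forall i j, i < m -> j < n -> f i j < c) ->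
  exists col : colouring m n c, forall (i : 'I_m) (j : 'I_n), col i j = f i j :> nat.
Proof.
move=> f_lt; exists (fun (i : 'I_m) (j : 'I_n) => Ordinal (f_lt i j (ltn_ord i) (ltn_ord j))).
by [].
Qed.

Lemma Kvert_eqE (m n : nat) :
  ((forall i i' : 'I_m, (inl i == inl i' :> Kvert m n) = (i == i')) *
   (forall j j' : 'I_n, (inr j == inr j' :> Kvert m n) = (j == j')))%type.
Proof. by []. Qed.

Section ShortCycles.
Variables (m n c : nat) (col : colouring m n c).

Lemma rainbow_square (i i' : 'I_m) (j j' : 'I_n) : i != i' -> j != j' ->
  uniq [:: col i j; col i' j; col i' j'; col i j'] ->
  rainbow_cycle col [:: inl i; inr j; inl i'; inr j'].
Proof.
move=> ni nj; rewrite -(map_inj_uniq val_inj) rainbow_consE /= => ->.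
by rewrite !inE /= !Kvert_eqE ?orbF ?andbT ni.
Qed.

Lemma rainbow_hexagon (u v w : 'I_m) (j j' j'' : 'I_n) :
  uniq [:: u; v; w] -> uniq [:: j; j'; j''] ->
  uniq [:: col u j; col v j; col v j'; col w j'; col w j''; col u j''] ->
  rainbow_cycle col [:: inl u; inr j; inl v; inr j'; inl w; inr j''].
Proof.
move=> Ul Ur; rewrite -(map_inj_uniq val_inj) rainbow_consE /= => ->.
move: Ul Ur; rewrite /= !inE /= !orbF !andbT !negb_or !Kvert_eqE.
by case/andP=> -> -> /andP[-> ->].
Qed.

Lemma two_rainbow_cycle_col :
    (forall i i', i != i' ->
      exists s, [/\ rainbow_cycle col s, inl i \in s & inl i' \in s]) ->
    (forall i j, exists s, [/\ rainbow_cycle col s, inl i \in s & inr j \in s]) ->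
    (forall j j', j != j' ->
      exists s, [/\ rainbow_cycle col s, inr j \in s & inr j' \in s]) ->
  k_rainbow_cycle_col 2 col.
Proof.
move=> LL LR RR S /eqP/cards2P[x [y [neq_xy ->]]].
suff [s [rb_s xs ys]] : exists s, [/\ rainbow_cycle col s, x \in s & y \in s].
  by exists s; split=> // z; rewrite !inE => /orP[]/eqP->.
case: x y neq_xy => [i|j] [i'|j'] neq.
- exact: LL.
- exact: LR.
- by have [s []] := LR i' j; exists s.
- exact: RR.
Qed.

End ShortCycles.

(** The colour records which ends of the edge are the vertex 0 of their class, so a square with
    exactly one vertex 0 in each class shows all four colours. *)
Lemma crx1_upper (m n : nat) : 2 <= m -> 2 <= n -> crx_feasible 1 m n 4.
Proof.
move=> m_ge2 n_ge2; pose f i j := 2 * (i != 0) + (j != 0).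
have [i j _ _|col colE] := @colouring_of_nat m n 4 f.
  by rewrite /f; do 2!case: eqP.
have partner q (i : 'I_q) : 2 <= q -> exists i' : 'I_q, (i' == 0 :> nat) = (i != 0 :> nat).
  move=> q_ge2; have [i0|ni0] := eqVneq (i : nat) 0; last by exists (Ordinal (ltnW q_ge2)).
  by exists (Ordinal q_ge2).
have square i j : exists s, [/\ rainbow_cycle col s, inl i \in s & inr j \in s].
  have [i' Ei] := partner _ i m_ge2; have [j' Ej] := partner _ j n_ge2.
  exists [:: inl i; inr j; inl i'; inr j']; split; rewrite ?inE ?eqxx ?orbT //.
  apply: rainbow_square.
  - by rewrite -val_eqE /=; apply: contra_eq_neq Ei => ->; case: (_ == 0).
  - by rewrite -val_eqE /=; apply: contra_eq_neq Ej => ->; case: (_ == 0).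
  - rewrite -(map_inj_uniq val_inj) /= !colE /f Ei Ej.
    by case: eqP; case: eqP.
exists col => S /eqP/cards1P[[i|j] ->].
  have [s [rb_s xs _]] := square i (Ordinal (ltnW n_ge2)).
  by exists s; split=> // x; rewrite inE => /eqP->.
have [s [rb_s _ xs]] := square (Ordinal (ltnW m_ge2)) j.
by exists s; split=> // x; rewrite inE => /eqP->.
Qed.

(** Turns [7 ^ m < n] into the [2 * m] right vertices needed by the colouring with eight colours. *)
Lemma double_le_exp7 (m : nat) : 2 * m <= 7 ^ m.
Proof. by elim: m => // m IH; rewrite expnS; have := expn_gt0 7 m; lia. Qed.

(** Call left vertices rows and right vertices columns. Even and odd columns use separate palettes
    of four colours. In [base], a row [i < 4] is constant, and a row [i >= 4] is 1 on the columns
    [2i] and [2i + 1] and 0 elsewhere. So any two rows differ on both columns [2p] and [2p + 1] for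
    some [p < m]. *)
Lemma crx2_eight_colours (m n : nat) : 4 <= m -> 2 * m <= n -> crx_feasible 2 m n 8.
Proof.
move=> m_ge4 n_ge; pose base i j := if i < 4 then i else (i == j./2) : nat.
pose f i j := 4 * odd j + base i j.
have base_lt i j : base i j < 4 by rewrite /base; case: ifP => // _; case: (i == _).
have [i j _ _|col colE] := @colouring_of_nat m n 8 f.
  by rewrite /f; have := base_lt i j; case: odd; lia.
have lt_m u : u < 4 -> u < m by move=> /leq_trans->.
have lt_n u : u < 8 -> u < n by move=> /leq_trans->//; lia.
pose L u (hu : u < 4) : 'I_m := Ordinal (lt_m u hu).
pose R u (hu : u < 8) : 'I_n := Ordinal (lt_n u hu).
have square (i i' : 'I_m) (j j' : 'I_n) : odd j != odd j' ->
    base i j != base i' j -> base i j' != base i' j' ->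
  rainbow_cycle col [:: inl i; inr j; inl i'; inr j'].
  move=> oj bj bj'; apply: rainbow_square.
  - by apply: contraNneq bj => ->.
  - by apply: contraNneq oj => ->.
  - rewrite -(map_inj_uniq val_inj) /= !inE !colE /f.
    have := base_lt i j; have := base_lt i' j; have := base_lt i j'.
    have := base_lt i' j'; move: bj bj' oj.
    by case: odd; case: odd => //; lia.
exists col; apply: two_rainbow_cycle_col.
- move=> i i' neq_ii'.
  (* Two rows below 4 differ everywhere. A row from 4 on is separated from row 0, or from another
     such row, on its own pair of columns, and from rows 1 to 3 on the pair 0. *)
  have [p lt_pm [b1 b2]] : exists2 p, p < m &
      base i p.*2 != base i' p.*2 /\ base i p.*2.+1 != base i' p.*2.+1.
    rewrite -val_eqE /= in neq_ii'.
    exists (if i < 4 then if i' < 4 then 0 else if i == 0 :> nat then nat_of_ord i' else 0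
            else if i' < 4 then if i' == 0 :> nat then nat_of_ord i else 0 else nat_of_ord i).
      by have := ltn_ord i; have := ltn_ord i'; do !case: ifP; lia.
    rewrite /base; do !case: ifP; rewrite ?uphalf_double ?doubleK /=; lia.
  have lt_j : p.*2 < n by lia.
  have lt_j' : p.*2.+1 < n by lia.
  exists [:: inl i; inr (Ordinal lt_j); inl i'; inr (Ordinal lt_j')].
  split; rewrite ?inE ?eqxx ?orbT //; apply: square => //=.
  by rewrite odd_double.
- move=> i j; have [j' oj] : exists j' : 'I_n, odd j != odd j'.
    by case oj: (odd j); [exists (R 0 isT) | exists (R 1 isT)].
  (* For [i < 4] the values of [base] are [i] itself, so any other row below 4 does; for [i >= 4]
     they are 0 or 1, and row 2 does. *)
  have [u [hu b1 b2 ne]] : exists u, [/\ u < 4, u != base i j, u != base i j' & u != i].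
    exists (if i < 4 then i == 0 :> nat : nat else 2); rewrite /base.
    case: ifP => lt_i4; last by split=> //; lia.
    by case: (eqVneq (i : nat) 0) => [->|] //; split=> //; lia.
  exists [:: inl i; inr j; inl (L u hu); inr j'].
  split; rewrite ?inE ?eqxx ?orbT //; apply: square => //=.
    by rewrite {2}/base hu eq_sym.
  by rewrite {2}/base hu eq_sym.
- move=> j j' neq_jj'; case: (eqVneq (odd j) (odd j')) => [eq_o|ne_o]; last first.
    exists [:: inl (L 0 isT); inr j; inl (L 1 isT); inr j'].
    by split; rewrite ?inE ?eqxx ?orbT //; apply: square.
  (* Columns of equal parity lie on an octagon through rows 0 to 3 and two columns of the other
     parity; each of the eight colours occurs on it once. *)
  have [a [b [neq_ab oa ob]]] : exists a b : 'I_n, [/\ a != b, odd a = ~~ odd j & odd b = ~~ odd j].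
    case: (odd j); first by exists (R 0 isT), (R 2 isT).
    by exists (R 1 isT), (R 3 isT).
  exists [:: inl (L 0 isT); inr j; inl (L 1 isT); inr a; inl (L 2 isT); inr j';
             inl (L 3 isT); inr b].
  split; rewrite ?inE ?eqxx ?orbT //; rewrite rainbow_consE /=.
  have ne1 : j != a by apply: contra_eqN oa => /eqP->; case: odd.
  have ne2 : j != b by apply: contra_eqN ob => /eqP->; case: odd.
  have ne3 : j' != a by apply: contra_eqN oa => /eqP<-; rewrite eq_o; case: odd.
  have ne4 : j' != b by apply: contra_eqN ob => /eqP<-; rewrite eq_o; case: odd.
  rewrite !inE !colE /f /base /= oa ob -eq_o.
  rewrite !Kvert_eqE !negb_or ne1 neq_jj' ne2 (eq_sym a j') ne3 neq_ab ne4.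
  by case: odd.
Qed.

(* Two columns admit a rainbow square unless their coincidences cannot be covered by one row; then there are two of them and a rainbow hexagon through a third column disjoint from both works. *)
Lemma square_or_hexagon (T : eqType) (A B : 'I_3 -> T) :
    injective A -> injective B -> ~ (forall i, exists i', A i = B i') ->
  exists u v w, uniq [:: u; v; w] /\
    (uniq [:: A u; A v; B v; B u] \/ uniq [:: A u; A v; B v; B w]).
Proof.
move=> injA injB neqAB.
pose o0 : 'I_3 := ord0; pose o1 : 'I_3 := inord 1; pose o2 : 'I_3 := inord 2.
have ne01 : o0 != o1 by rewrite -val_eqE /= inordK.
have ne02 : o0 != o2 by rewrite -val_eqE /= inordK.
have ne12 : o1 != o2 by rewrite -val_eqE /= !inordK.
have o_ind (P : 'I_3 -> Prop) : P o0 -> P o1 -> P o2 -> forall i, P i.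
  move=> P0 P1 P2 i; have: (i : nat) \in [:: 0; 1; 2] by case: i => [[|[|[]]]].
  rewrite !inE => /or3P[]/eqP vi; [suff -> : i = o0 by []| suff -> : i = o1 by []|
    suff -> : i = o2 by []]; by apply/val_inj; rewrite /= ?inordK.
(* The coincidence matrix of the two columns; by injectivity it has at most one true entry in each
   row and column. *)
pose E i j := A i == B j.
have row i j j' : j != j' -> ~~ (E i j && E i j').
  by apply: contraNN => /andP[/eqP eqA /eqP]; rewrite eqA => /injB->.
have column i i' j : i != i' -> ~~ (E i j && E i' j).
  by apply: contraNN => /andP[/eqP eqB /eqP]; rewrite -eqB => /injA->.
have not_all : ~~ [&& E o0 o0 || E o0 o1 || E o0 o2, E o1 o0 || E o1 o1 || E o1 o2
                    & E o2 o0 || E o2 o1 || E o2 o2].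
  apply/negP => /and3P[r0 r1 r2]; apply: neqAB; apply: o_ind.
  - by case/orP: r0 => [/orP[]|] /eqP eqAB; eexists; exact: eqAB.
  - by case/orP: r1 => [/orP[]|] /eqP eqAB; eexists; exact: eqAB.
  - by case/orP: r2 => [/orP[]|] /eqP eqAB; eexists; exact: eqAB.
pose sq u v := ~~ [|| E u v, E u u, E v v | E v u].
pose hex u v w := ~~ [|| E u v, E u w, E v v | E v w].
have sqP u v w : uniq [:: u; v; w] -> sq u v -> uniq [:: A u; A v; B v; B u].
  rewrite /= !inE !(inj_eq injA) !(inj_eq injB) (eq_sym v u) /sq /E.
  by rewrite !negb_or !andbT -!andbA => /and3P[-> _ _] /and4P[-> -> -> ->].
have hexP u v w : uniq [:: u; v; w] -> hex u v w -> uniq [:: A u; A v; B v; B w].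
  rewrite /= !inE !(inj_eq injA) !(inj_eq injB) /hex /E.
  by rewrite !negb_or !andbT -!andbA => /and3P[-> _ ->] /and4P[-> -> -> ->].
suff: [|| sq o0 o1, sq o0 o2, sq o1 o2, hex o0 o1 o2, hex o0 o2 o1, hex o1 o0 o2,
          hex o1 o2 o0, hex o2 o0 o1 | hex o2 o1 o0].
  have U u v w : u != v -> u != w -> v != w -> uniq [:: u; v; w].
    by rewrite /= !inE negb_or => -> -> ->.
  have fin u v w : uniq [:: u; v; w] -> sq u v || hex u v w -> exists u v w,
      uniq [:: u; v; w] /\
      (uniq [:: A u; A v; B v; B u] \/ uniq [:: A u; A v; B v; B w]).
    by move=> Uuvw /orP[/(sqP _ _ _ Uuvw)|/(hexP _ _ _ Uuvw)]; exists u, v, w; auto.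
  have [s01 s02 s12] : [/\ o1 != o0, o2 != o0 & o2 != o1].
    by rewrite !(eq_sym o2) eq_sym.
  case/orP=> [ok|/orP[ok|/orP[ok|/orP[ok|/orP[ok|/orP[ok|/orP[ok|/orP[ok|ok]]]]]]]].
  - by apply: (fin o0 o1 o2); rewrite ?U ?ok.
  - by apply: (fin o0 o2 o1); rewrite ?U ?ok.
  - by apply: (fin o1 o2 o0); rewrite ?U ?ok.
  - by apply: (fin o0 o1 o2); rewrite ?U ?ok ?orbT.
  - by apply: (fin o0 o2 o1); rewrite ?U ?ok ?orbT.
  - by apply: (fin o1 o0 o2); rewrite ?U ?ok ?orbT.
  - by apply: (fin o1 o2 o0); rewrite ?U ?ok ?orbT.
  - by apply: (fin o2 o0 o1); rewrite ?U ?ok ?orbT.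
  - by apply: (fin o2 o1 o0); rewrite ?U ?ok ?orbT.
have := (column _ _ o0 ne01, column _ _ o0 ne02, column _ _ o0 ne12,
  column _ _ o1 ne01, column _ _ o1 ne02, column _ _ o1 ne12,
  column _ _ o2 ne01, column _ _ o2 ne02, column _ _ o2 ne12).
have := (row o0 _ _ ne01, row o0 _ _ ne02, row o0 _ _ ne12,
  row o1 _ _ ne01, row o1 _ _ ne02, row o1 _ _ ne12,
  row o2 _ _ ne01, row o2 _ _ ne02, row o2 _ _ ne12).
(* What remains is a finite check of the Boolean 3 by 3 matrices with these row and column
   constraints and an empty row. *)
move: not_all; rewrite /sq /hex.
case: (E o0 o0); case: (E o0 o1); case: (E o0 o2); case: (E o1 o0); case: (E o1 o1);
  case: (E o1 o2); case: (E o2 o0); case: (E o2 o1); case: (E o2 o2);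
  by move=> //= _ [[[[[[[[? ?] ?] ?] ?] ?] ?] ?] ?] [[[[[[[[? ?] ?] ?] ?] ?] ?] ?] ?].
Qed.

(** A right vertex avoiding the colours already used closes the cycle: a square if a left vertex is
    prescribed, a hexagon if two right vertices admit only the path of [square_or_hexagon], which
    has four edges. *)
Lemma crx2_K3n_criterion (n c : nat) (col : colouring 3 n c) :
    0 < n -> (forall j, injective (col^~ j)) ->
    (forall j j', j != j' -> ~ (forall i, exists i', col i j = col i' j')) ->
    (forall Q : seq 'I_c, size Q <= 4 -> exists j, forall i, col i j \notin Q) ->
  k_rainbow_cycle_col 2 col.
Proof.
move=> n_gt0 col_inj col_neq avoid.
have other (i : 'I_3) : exists i', i != i'.
  exists (if i == ord0 then inord 1 else ord0).
  by case: (eqVneq i ord0) => [->|] //; rewrite -val_eqE /= inordK.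
have square (i i' : 'I_3) j : i != i' ->
    exists j', rainbow_cycle col [:: inl i; inr j; inl i'; inr j'].
  move=> neq_ii'; have [j' Qj'] := avoid [:: col i j; col i' j] isT.
  exists j'; apply: rainbow_square => //.
    by apply: contraNneq (Qj' i) => <-; rewrite inE eqxx.
  have := Qj' i; have := Qj' i'; rewrite /= !inE !negb_or !andbT.
  rewrite !(inj_eq (col_inj _)) (eq_sym i' i) neq_ii' /=.
  by rewrite !(eq_sym (col _ j')) => /andP[-> ->] /andP[-> ->].
apply: two_rainbow_cycle_col.
- move=> i i' neq_ii'; have [j' rb] := square i i' (Ordinal n_gt0) neq_ii'.
  by exists [:: inl i; inr (Ordinal n_gt0); inl i'; inr j']; rewrite !inE !eqxx !orbT.
- move=> i j; have [i' neq_ii'] := other i; have [j' rb] := square i i' j neq_ii'.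
  by exists [:: inl i; inr j; inl i'; inr j']; rewrite !inE !eqxx !orbT.
- move=> j j' neq_jj'.
  have [u [v [w [Uuvw [sq|hex]]]]] :=
      square_or_hexagon (@col_inj j) (@col_inj j') (col_neq _ _ neq_jj').
    exists [:: inl u; inr j; inl v; inr j']; rewrite !inE !eqxx !orbT.
    by split=> //; apply: rainbow_square => //; case/andP: Uuvw; rewrite inE negb_or => /andP[].
  have [j'' Qj''] := avoid [:: col u j; col v j; col v j'; col w j'] isT.
  exists [:: inl u; inr j; inl v; inr j'; inl w; inr j'']; rewrite !inE !eqxx !orbT.
  split=> //; apply: rainbow_hexagon => //.
    rewrite /= !inE negb_or neq_jj' andbT /=; apply/andP; split.
      by apply: contraNneq (Qj'' u) => <-; rewrite inE eqxx.
    by apply: contraNneq (Qj'' v) => <-; rewrite !inE eqxx !orbT.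
  rewrite -[_ :: _]/([:: col u j; col v j; col v j'; col w j'] ++ _).
  rewrite cat_uniq hex /= !(negbTE (Qj'' _)) /= inE (inj_eq (col_inj _)) andbT.
  by move: Uuvw; rewrite /= !inE !negb_or (eq_sym w u) => /andP[/andP[_ ->]].
Qed.

Lemma card_ord_lt (n q : nat) : q <= n -> #|[set j : 'I_n | j < q]| = q.
Proof.
move=> le_qn; rewrite -[RHS]card_ord -cardsT.
have inj : injective (widen_ord le_qn) by move=> i j [eqij]; apply: val_inj.
rewrite -(card_imset _ inj).
apply: eq_card => j; rewrite inE; apply/idP/imsetP => [lt_jq|[i _ ->]]; last exact: (ltn_ord i).
by exists (Ordinal lt_jq) => //; apply: val_inj.
Qed.

Lemma enum_val_cover (T : finType) (A : {set T}) (k : nat) (e : #|A| = k) (x : T) :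
  x \in A -> exists i : 'I_k, enum_val (cast_ord (esym e) i) = x.
Proof.
by move=> xA; exists (cast_ord e (enum_rank_in xA x)); rewrite cast_ordK enum_rankK_in.
Qed.

(* The chosen family contains all triples from a fixed 7-set of colours, so any four colours are avoided by one of them. *)
Lemma crx2_K3n_upper (n r : nat) :
  35 < n <= 'C(r, 3) -> 7 <= r -> crx_feasible 2 3 n r.
Proof.
case/andP=> n_gt n_le r_ge7.
pose D := [set A : {set 'I_r} | #|A| == 3].
pose B7 := [set a : 'I_r | a < 7].
(* Since ['C(7, 3) = 35 < n], all triples from seven colours fit into the family. *)
pose D7 := [set A : {set 'I_r} | A \subset B7 & #|A| == 3].
have sD7 : D7 \subset D by apply/subsetP=> A; rewrite !inE => /andP[].
have cardD : #|D| = 'C(r, 3) by rewrite card_draws card_ord.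
have cardD7 : #|D7| = 35 by rewrite cards_draws card_ord_lt.
have [F [sD7F sFD cardF]] : exists F : {set {set 'I_r}}, [/\ D7 \subset F, F \subset D & #|F| = n].
  by apply: exists_set_between; rewrite // cardD cardD7 ltnW.
pose T (j : 'I_n) := enum_val (cast_ord (esym cardF) j).
have cardT j : #|T j| = 3.
  by have := subsetP sFD _ (enum_valP (cast_ord (esym cardF) j)); rewrite inE => /eqP.
pose col (i : 'I_3) (j : 'I_n) := enum_val (cast_ord (esym (cardT j)) i).
have colT i j : col i j \in T j by apply: enum_valP.
have T_inj : injective T by move=> j j' /enum_val_inj/cast_ord_inj.
exists col; apply: crx2_K3n_criterion.
- exact: leq_trans n_gt.
- by move=> j i i' /enum_val_inj/cast_ord_inj.
- move=> j j' /eqP neq_jj' sub; apply/neq_jj'/T_inj/eqP.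
  rewrite eqEcard !cardT andbT; apply/subsetP=> a.
  by case/(enum_val_cover (cardT j)) => i <-; have [i' eqc] := sub i; rewrite -/(col i j) eqc.
- move=> Q size_Q.
  (* Removing at most four of the seven colours leaves a triple. *)
  have /card_geqP[t [Ut size_t tB]] : 3 <= #|B7 :\: [set a in Q]|.
    rewrite cardsD card_ord_lt //; apply: (@leq_sub2l 7 _ 4).
    apply: leq_trans (subset_leq_card (subsetIr _ _)) _.
    by rewrite cardsE; apply: leq_trans (card_size _) size_Q.
  have tF : [set a in t] \in F.
    apply: (subsetP sD7F); rewrite inE cardsE (card_uniqP Ut) size_t eqxx andbT.
    by apply/subsetP=> a; rewrite inE => /tB/setDP[].
  have [j Tj] := enum_val_cover cardF tF; exists j => i.
  by have := colT i j; rewrite /T Tj inE => /tB/setDP[_]; rewrite inE.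
Qed.

Lemma bin3_ge8 (n r : nat) : 36 <= n -> n <= 'C(r, 3) -> 8 <= r.
Proof.
move=> n_ge n_le; rewrite ltnNge; apply/negP => /(leq_bin2l 3).
by move=> /(leq_trans n_le)/(leq_trans n_ge).
Qed.

(** From [(r-1)(r-2)(r-3) < 6n <= r(r-1)(r-2)] the number [6n] lies strictly between the cubes of
    [r-3] and [r-1]. *)
Lemma cbrt_bounds (n r : nat) : 8 <= r -> 'C(r.-1, 3) < n <= 'C(r, 3) ->
  Rlt (INR 1) (Rminus (INR r) (Rpower (INR (6 * n)) (Rinv (INR 3)))) /\
  Rlt (Rminus (INR r) (Rpower (INR (6 * n)) (Rinv (INR 3)))) (INR 3).
Proof.
(* From here on [r] is the original value minus 3, so the cube root must lie strictly between [r]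
   and [r.+2]. *)
case: r => [|[|[|r]]] // r_ge /andP[lo hi].
have ffact3 q : 6 * 'C(q.+2, 3) = q.+2 * q.+1 * q.
  by rewrite mulnC (bin_ffact q.+2 3) !ffactnS ffactn0 muln1 /= mulnA.
have lt_lo : r ^ 3 < 6 * n by move: lo (ffact3 r) => /=; nia.
have lt_hi : 6 * n < r.+2 ^ 3 by move: hi (ffact3 r.+1) => /=; nia.
have cbrt q : 0 < q -> Rpower (INR (q ^ 3)) (/ INR 3) = INR q.
  move=> q_gt0; have q_gt0' : Rlt 0 (INR q) by apply/lt_0_INR/ltP.
  have -> : INR (q ^ 3) = pow (INR q) 3 by rewrite !expnS expn0 !mult_INR /=; ring.
  rewrite -Rpower_pow // Rpower_mult Rinv_r ?Rpower_1 //.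
  by apply: not_0_INR.
have inv3 : Rlt 0 (/ INR 3) by apply/Rinv_0_lt_compat/lt_0_INR/ltP.
have := Rlt_Rpower_l (INR (r ^ 3)) (INR (6 * n)) _ inv3.
have := Rlt_Rpower_l (INR (6 * n)) (INR (r.+2 ^ 3)) _ inv3.
rewrite !cbrt //; last by lia.
have INR_lt a b : a < b -> Rlt (INR a) (INR b) by move=> /ltP; apply: lt_INR.
move=> H1 H2; have {}H1 : Rlt (Rpower (INR (6 * n)) (/ INR 3)) (INR r.+2).
  apply: H1; split; last exact: INR_lt.
  by apply: (INR_lt 0); apply: leq_ltn_trans lt_lo.
have {}H2 : Rlt (INR r) (Rpower (INR (6 * n)) (/ INR 3)).
  apply: H2; split; last exact: INR_lt.
  by apply: (INR_lt 0); rewrite expn_gt0; lia.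
by move: H1 H2; rewrite !S_INR /=; split; lra.
Qed.

(** * Cycles assembled from blocks *)

Section Blocks.
Variable T : eqType.
Implicit Types (X Y : seq (seq T)) (u : seq T).

(** A cycle is described by parallel lists of vertices: each becomes a list of one-vertex blocks,
    [zipcat] glues the blocks of equal index, and [flatten] then interleaves the lists. *)
Definition singletons u := [seq [:: x] | x <- u].
Definition zipcat X Y := [seq p.1 ++ p.2 | p <- zip X Y].

Lemma size_zipcat X Y : size (zipcat X Y) = minn (size X) (size Y).
Proof. by rewrite size_map size_zip. Qed.

Lemma size_singletons u : size (singletons u) = size u.
Proof. exact: size_map. Qed.

Lemma nth_zipcat X Y t : size X = size Y ->
  nth [::] (zipcat X Y) t = nth [::] X t ++ nth [::] Y t.
Proof.
move=> eqXY; have [lt_t|ge_t] := ltnP t (size X); last first.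
  by rewrite !nth_default ?size_zipcat -?eqXY ?minnn.
by rewrite (nth_map ([::], [::])) ?size_zip -?eqXY ?minnn // nth_zip.
Qed.

Lemma nth_singletons x0 u t : t < size u ->
  nth [::] (singletons u) t = [:: nth x0 u t].
Proof. exact: nth_map. Qed.

Lemma flatten_singletons u : flatten (singletons u) = u.
Proof. exact: flatten_seq1. Qed.

(** Membership and distinctness in an interleaved cycle can thus be checked on the lists it is made
    from. *)
Lemma perm_flatten_zipcat X Y : size X = size Y ->
  perm_eq (flatten (zipcat X Y)) (flatten X ++ flatten Y).
Proof.
elim: X Y => [|x X IH] [|y Y] //= [/IH {}IH].
by rewrite -!catA perm_cat2l perm_sym perm_catCA perm_cat2l perm_sym.
Qed.

End Blocks.

Section BlockPaths.
Variables (T : eqType) (C : Type) (e : rel T) (g : T -> T -> C) (P : pred T).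

Definition path_colours (u : seq T) : seq C :=
  if u is x :: p then pairmap g x p else [::].

(* A block contributes the colours of its edges up to the first vertex of the next block, which must not depend on that vertex as long as it satisfies P. *)
Definition good_block (b : seq T) (cs : seq C) : Prop :=
  if b is x :: p then
    P x /\ forall y, P y -> path e x (rcons p y) /\ pairmap g x (rcons p y) = cs
  else False.

(** Induction on the blocks: whatever follows a block begins with a vertex satisfying [P], which is
    all that the block requires of its continuation. *)
Lemma flatten_good_blocks (X : seq (seq T)) (K : seq (seq C)) y :
    size X = size K ->
    (forall t, t < size X -> good_block (nth [::] X t) (nth [::] K t)) -> P y ->
  let u := rcons (flatten X) y in
  [/\ P (head y u), sorted e u & path_colours u = flatten K].
Proof.
elim: X K => [|b X IH] [|cs K] //= [/IH {}IH] good Py.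
have [Ph sr cr] := IH (fun t => good t.+1) Py.
have := good 0 isT; case: b {good IH} => //= x p [Px goodt].
rewrite rcons_cat; case Er: (rcons _ y) Ph sr cr => [|z q] /=.
  by case: (flatten _) Er.
move=> Pz sr cr; have [pz cz] := goodt z Pz; split=> //.
  by rewrite -cat_rcons cat_path pz last_rcons.
by rewrite -cat_rcons pairmap_cat last_rcons cz cr.
Qed.

(** The head of the first block satisfies [P], so it can serve as the closing vertex [y]. *)
Lemma flatten_good_cycle (X : seq (seq T)) (K : seq (seq C)) :
    size X = size K ->
    (forall t, t < size X -> good_block (nth [::] X t) (nth [::] K t)) ->
  if flatten X is x :: p then
    path e x (rcons p x) /\ pairmap g x (rcons p x) = flatten K
  else X = [::].
Proof.
move=> eq_size good; have := flatten_good_blocks eq_size good.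
case: X good eq_size => // b X good _; have := good 0 isT.
case: b {good} => //= x p [Px _] fin.
by have [] := fin x Px.
Qed.

End BlockPaths.

(** * Injective colourings and the bound [k * n] *)

Section BlockCycles.
Variables (m n c : nat) (col : colouring m n c).

Lemma next_next_neq (s : seq (Kvert m n)) x : is_cycle s -> x \in s ->
  next s (next s x) != x.
Proof.
case/and3P=> sz Us _ xs; have [i s' Es] := rot_to xs.
move: sz; rewrite -(size_rot i) -!(next_rot i Us) Es.
move: Us; rewrite -(rot_uniq i) Es; case: s' {Es} => [|y [|z s']] //= + _.
rewrite eqxx !inE !negb_or -!andbA => /and5P[nxy nxz _ nyz _].
by rewrite (eq_sym y x) (negbTE nxy) eqxx eq_sym.
Qed.

(** Equal colours mean the same edge. Its two tails then agree unless the cycle runs along it in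
    both directions, which [next_next_neq] excludes. *)
Lemma inj_rainbow (s : seq (Kvert m n)) :
  (forall i j i' j', col i j = col i' j' -> i = i' /\ j = j') ->
  is_cycle s -> rainbow_cycle col s.
Proof.
move=> col_inj cyc_s; have /and3P[_ Us Cs] := cyc_s.
rewrite rainbow_step cyc_s map_inj_in_uniq // => x y xs ys.
have := next_cycle Cs xs; have := next_cycle Cs ys.
have := next_next_neq cyc_s xs; have := next_next_neq cyc_s ys.
have := next_cycle Cs ys; have := next_cycle Cs xs.
rewrite /step_col.
case: x xs => [i|j] xs; case: y ys => [i'|j'] ys;
  case Ex: (next s _) => [u|u]; case Ey: (next s _) => [v|v] //= _ _ n1 n2 _ _ /val_inj/col_inj[];
  by move=> *; subst; move: n1 n2; rewrite ?Ex ?Ey ?eqxx.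
Qed.

End BlockCycles.

(** All edges get different colours, so any cycle is rainbow; one alternating between all left
    vertices and [k] right vertices that include those of [S] will do. *)
Lemma crx_Kkn_upper (k n : nat) : 2 <= k <= n -> crx_feasible k k n (k * n).
Proof.
case/andP=> k_ge2 le_kn.
have [i j lt_ik lt_jn|col colE] := @colouring_of_nat k n (k * n) (fun i j => i * n + j).
  by nia.
have col_inj i j i' j' : col i j = col i' j' -> i = i' /\ j = j'.
  move/(congr1 val); rewrite /= !colE => eqc.
  have n_gt0 : 0 < n by apply: leq_trans (ltnW k_ge2) le_kn.
  have := congr1 (divn^~ n) eqc; have := congr1 (modn^~ n) eqc.
  rewrite !modnMDl !modn_small // !divnMDl // !divn_small // !addn0.
  by move=> /val_inj-> /val_inj->.
exists col => S cardS.
have [A [sSA _ cardA]] : exists A : {set 'I_n}, [/\ [set j | inr j \in S] \subset A,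
    A \subset setT & #|A| = k].
  apply: exists_set_between; rewrite ?subsetT // cardsT card_ord le_kn andbT.
  have inr_inj: injective (inr : 'I_n -> Kvert k n) by move=> ? ? [].
  apply: (@leq_trans #|S|); last by rewrite cardS.
  rewrite -(card_imset _ inr_inj); apply/subset_leq_card/subsetP => x.
  by case/imsetP=> j; rewrite inE => jS ->.
pose s := flatten (zipcat (singletons [seq inl i | i <- enum [set: 'I_k]])
                          (singletons [seq inr j | j <- enum A])) : seq (Kvert k n).
(* Only adjacency is wanted from the blocks, so their two edges carry colours in [unit]. *)
have sizeX : size (zipcat (singletons [seq inl i | i <- enum [set: 'I_k]])
    (singletons [seq (inr j : Kvert k n) | j <- enum A])) = size (nseq k [:: tt; tt]).
  by rewrite size_zipcat !size_singletons !size_map -!cardE cardsT card_ord cardA minnn size_nseq.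
have perm_s : perm_eq s ([seq inl i | i <- enum [set: 'I_k]] ++ [seq inr j | j <- enum A]).
  rewrite /s (perm_trans (perm_flatten_zipcat _)) ?flatten_singletons //.
  by rewrite !size_singletons !size_map -!cardE cardsT card_ord.
exists s; split; last first.
  move=> x xS; rewrite (perm_mem perm_s) mem_cat.
  case: x xS => [i|j] xS; first by rewrite map_f // mem_enum inE.
  by rewrite [X in _ || X]map_f ?orbT // mem_enum (subsetP sSA) ?inE.
apply: inj_rainbow col_inj _; rewrite /is_cycle (perm_size perm_s) (perm_uniq perm_s).
rewrite size_cat !size_map -!cardE cardsT card_ord cardA cat_uniq !map_inj_uniq ?enum_uniq.
- have lt_4 : 2 < k + k by lia.
  rewrite lt_4 /= andbT; apply/andP; split.
    by apply/hasPn => _ /mapP[j _ ->]; apply/negP => /mapP[].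
  have := flatten_good_cycle (e := @Kadj k n) (g := fun _ _ => tt)
    (P := @left_class k n) sizeX.
  have i0 : 'I_k by apply: (Ordinal (ltnW k_ge2)).
  have j0 : 'I_n by apply: (Ordinal (leq_trans (ltnW k_ge2) le_kn)).
  rewrite -/s; have s_neq0 : s != [::].
    by rewrite -size_eq0 (perm_size perm_s) size_cat !size_map -!cardE cardsT card_ord cardA; lia.
  case: s {perm_s} s_neq0 => //= x p _ [|//]; rewrite sizeX size_nseq => t lt_t.
  rewrite nth_zipcat ?size_singletons ?size_map -?cardE ?cardsT ?card_ord ?cardA //.
  rewrite (nth_singletons (inl i0)) ?size_map -?cardE ?cardsT ?card_ord //.
  rewrite (nth_singletons (inr j0)) ?size_map -?cardE ?cardA //.
  rewrite (nth_map i0) -?cardE ?cardsT ?card_ord // (nth_map j0) -?cardE ?cardA //.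
  by rewrite nth_nseq lt_t; split=> // -[y|y].
- by move=> ? ? [].
- by move=> ? ? [].
Qed.

(** * The bound 6k *)

(* The last value is never used: in the cycles below the right vertices 3k <= j are adjacent only to left vertices i < 2k. *)
Definition six_colour (k i j : nat) : nat :=
  if j < 3 * k then 3 * k * (2 * k <= i) + j
  else if i < 2 * k then 3 * k * odd i + i./2 else 0.

Lemma six_colour_lt (k i j : nat) : 0 < k -> six_colour k i j < 6 * k.
Proof.
rewrite /six_colour => k_gt0; case: (ltnP j) => lt_j; first by case: (_ <= i); lia.
by case: (ltnP i) => lt_i; case: (odd i); lia.
Qed.

Lemma code_inj (k x y : nat) (a b : bool) :
  x < k -> y < k -> 3 * k * a + x = 3 * k * b + y -> a = b /\ x = y.
Proof. by case: a; case: b; split; lia. Qed.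

(** With [code_high], this shows that an edge leaving the core can share a colour with an edge at
    the core vertex [j] only if its offset is [j]. *)
Lemma code_low (k x j : nat) (a : bool) :
  x < k -> j < 3 * k -> 3 * k * a + x = j -> x = j.
Proof. by case: a; lia. Qed.

Lemma code_high (k x j : nat) (a : bool) :
  x < k -> j < 3 * k -> 3 * k * a + x = 3 * k + j -> x = j.
Proof. by case: a; lia. Qed.

Lemma count_flatten_zipcat (T : eqType) (X Y : seq (seq T)) (a : pred T) :
  size X = size Y ->
  count a (flatten (zipcat X Y)) = count a (flatten X) + count a (flatten Y).
Proof. by move/perm_flatten_zipcat/permP->; rewrite count_cat. Qed.

(* The cycle consists of k blocks e d e' r q r' or p r q r' with e in E1, e' in E2, d in D, p in P, q in Q, r in R1, r' in R2. *)
Lemma six_colour_cycle (k m n : nat) (col : colouring m n (6 * k))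
    (E1 E2 P Q : seq 'I_m) (R1 R2 D : seq 'I_n) :
    (forall (i : 'I_m) (j : 'I_n), col i j = six_colour k i j :> nat) ->
    0 < k -> size E1 = size D -> size E2 = size D -> size D + size P = k ->
    size Q = k -> size R1 = k -> size R2 = k ->
    uniq (E1 ++ E2 ++ P) -> {in E1 ++ E2 ++ P, forall i : 'I_m, i < 2 * k} ->
    uniq Q -> {in Q, forall i : 'I_m, 2 * k <= i} ->
    uniq (R1 ++ R2) -> {in R1 ++ R2, forall j : 'I_n, j < 3 * k} ->
    uniq D -> {in D, forall j : 'I_n, 3 * k <= j} ->
    {in E1 ++ E2 & R1 ++ R2, forall (i : 'I_m) (j : 'I_n), i./2 != j} ->
  exists s, rainbow_cycle col s /\
    s =i [seq (inl i : Kvert m n) | i <- E1 ++ E2 ++ P ++ Q] ++ [seq (inr j : Kvert m n) | j <- D ++ R1 ++ R2].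
Proof.
move=> colE k_gt0 sE1 sE2 sDP sQ sR1 sR2 U0 lt0 UQ geQ UR ltR UD geD neER.
pose vl (u : seq 'I_m) := singletons [seq (inl i : Kvert m n) | i <- u].
pose vr (u : seq 'I_n) := singletons [seq (inr j : Kvert m n) | j <- u].
(* For left vertices below [2 * k], [kap] gives the colours outside the core and [lo] those in the
   core; [hi] gives the core colours at the other left vertices. *)
pose kap (i : 'I_m) := 3 * k * odd i + i./2.
pose lo (j : 'I_n) := j : nat.
pose hi (j : 'I_n) := 3 * k + j.
pose sg T (h : T -> nat) (u : seq T) := singletons (map h u).
pose X := zipcat (zipcat (vl E1) (zipcat (vr D) (vl E2)) ++ vl P)
                 (zipcat (vr R1) (zipcat (vl Q) (vr R2))).
(* The colours in the order of the edges of each block; the last one, [lo] of the vertex in [R2],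
   belongs to the edge to the next block. *)
pose K := zipcat (zipcat (sg _ kap E1) (sg _ kap E2) ++ nseq (size P) [::])
  (zipcat (sg _ lo R1) (zipcat (sg _ hi R1) (zipcat (sg _ hi R2) (sg _ lo R2)))).
have svl u : size (vl u) = size u by rewrite size_singletons size_map.
have svr u : size (vr u) = size u by rewrite size_singletons size_map.
have ssg T (h : T -> nat) u : size (sg _ h u) = size u by rewrite size_singletons size_map.
have sizes := (svl, svr, ssg, size_zipcat, size_cat, size_nseq, sE1, sE2, sDP, sQ, sR1, sR2, minnn).
have sizeX : size X = k by rewrite !sizes.
have sizeK : size K = k by rewrite !sizes.
(* Comparing counts of all predicates turns the rearrangement into linear arithmetic. *)
have countX a : count a (flatten X) =
    count a ([seq (inl i : Kvert m n) | i <- E1 ++ E2 ++ P ++ Q] ++ [seq (inr j : Kvert m n) | j <- D ++ R1 ++ R2]).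
  rewrite !(count_flatten_zipcat, flatten_cat, count_cat) ?sizes //.
  by rewrite !flatten_singletons !map_cat !count_cat; lia.
have countK a : count a (flatten K) =
    count a (map kap (E1 ++ E2) ++ map lo (R1 ++ R2) ++ map hi (R1 ++ R2)).
  rewrite !(count_flatten_zipcat, flatten_cat, count_cat) ?sizes //.
  rewrite !flatten_singletons !map_cat !count_cat.
  have -> : flatten (nseq (size P) ([::] : seq nat)) = [::] by elim: (size P).
  by rewrite /=; lia.
have permX := introT permP countX; have permK := introT permP countK.
have UX : uniq (flatten X).
  rewrite (perm_uniq permX) cat_uniq !map_inj_uniq; try by move=> ? ? [].
  rewrite catA catA -(catA E1) cat_uniq U0 UQ andbT /= cat_uniq UD UR andbT /=.
  apply/and3P; split.
  - by apply/hasPn => i /geQ; apply: contraL => /lt0; rewrite -ltnNge.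
  - by apply/hasPn => _ /mapP[j _ ->]; apply/negP => /mapP[].
  - by apply/hasPn => j /ltR; apply: contraL => /geD; rewrite -leqNgt.
have kapE i : i \in E1 ++ E2 -> i./2 < k /\ i = odd i + i./2.*2 :> nat.
  rewrite mem_cat => iE; rewrite odd_double_half; split=> //.
  have : i < 2 * k by apply: lt0; rewrite !mem_cat orbA iE.
  by rewrite mul2n -ltn_half_double.
have UK : uniq (flatten K).
  rewrite (perm_uniq permK) cat_uniq; apply/and3P; split.
  - rewrite map_inj_in_uniq; first by move: U0; rewrite catA cat_uniq => /and3P[].
    move=> i i' /kapE[lt_i Ei] /kapE[lt_i' Ei'] eqk; apply/val_inj.
    by have [eq_o eq_h] := code_inj lt_i lt_i' eqk; rewrite /= Ei Ei' eq_o eq_h.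
  (* A shared colour would force [i./2 = j], against [neER]. *)
  - apply/hasPn => z; rewrite mem_cat => zR; apply/negP => /mapP[i iE Ez].
    have [lt_i _] := kapE _ iE.
    case/orP: zR => /mapP[j jR]; rewrite Ez => eqj; have /eqP[] := neER _ _ iE jR.
      exact: code_low lt_i (ltR j jR) eqj.
    exact: code_high lt_i (ltR j jR) eqj.
  - rewrite cat_uniq !map_inj_uniq ?UR ?andbT /=.
    + apply/hasPn => _ /mapP[j _ ->]; apply/negP => /mapP[j' /ltR lt_j'].
      by apply/eqP; rewrite eq_sym neq_ltn (leq_trans lt_j') ?leq_addr.
    + by move=> j j' /addnI/val_inj.
    + exact: val_inj.
(* Every block starts at a left vertex below [2 * k], and this bound alone fixes the colour of the
   edge entering it from the core. *)
have good t : t < size X -> good_block (@Kadj m n) (ecol col)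
    (fun x => if x is inl i then i < 2 * k else false) (nth [::] X t) (nth [::] K t).
  rewrite sizeX => lt_t.
  have i0 : 'I_m by case: (Q) sQ k_gt0 => [<-|].
  have j0 : 'I_n by case: (R1) sR1 k_gt0 => [<-|].
  have nth_vl u t' : t' < size u -> nth [::] (vl u) t' = [:: inl (nth i0 u t')].
    by move=> lt_u; rewrite (nth_singletons (inl i0)) ?size_map // (nth_map i0).
  have nth_vr u t' : t' < size u -> nth [::] (vr u) t' = [:: inr (nth j0 u t')].
    by move=> lt_u; rewrite (nth_singletons (inr j0)) ?size_map // (nth_map j0).
  have nth_sg T (x0 : T) h u : t < size u -> nth [::] (sg _ h u) t = [:: h (nth x0 u t)].
    by move=> lt_u; rewrite (nth_singletons 0) ?size_map // (nth_map x0).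
  have tail_lt : nth j0 R1 t < 3 * k /\ nth j0 R2 t < 3 * k.
    by split; apply: ltR; rewrite mem_cat mem_nth ?orbT ?sR1 ?sR2.
  have tail_ge : 2 * k <= nth i0 Q t by apply: geQ; rewrite mem_nth ?sQ.
  rewrite !nth_zipcat ?sizes // !nth_cat !sizes.
  rewrite (nth_vr R1) ?sR1 // (nth_vr R2) ?sR2 // (nth_vl Q) ?sQ //.
  rewrite !(nth_sg _ j0 _ R1) ?sR1 // !(nth_sg _ j0 _ R2) ?sR2 //.
  move: tail_lt tail_ge; move: (nth i0 Q t) (nth j0 R1 t) (nth j0 R2 t) => q r1 r2.
  move=> [lt_r1 lt_r2] ge_q.
  have tailE (i : 'I_m) : i < 2 * k -> (col i r1 = r1 :> nat) * (col i r2 = r2 :> nat).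
    by move=> lt_i; rewrite !colE /six_colour lt_r1 lt_r2 leqNgt lt_i muln0.
  have qE : (col q r1 = 3 * k + r1 :> nat) * (col q r2 = 3 * k + r2 :> nat).
    by rewrite !colE /six_colour lt_r1 lt_r2 ge_q muln1.
  case: ltnP => [lt_tD|ge_tD]; last first.
    rewrite nth_nseq if_same nth_vl; last by rewrite -(ltn_add2l (size D)) sDP subnKC.
    have : nth i0 P (t - size D) < 2 * k.
      apply: lt0; rewrite !mem_cat mem_nth ?orbT //.
      by rewrite -(ltn_add2l (size D)) sDP subnKC.
    move: (nth i0 P _) => p lt_p /=; split=> // -[] // y lt_y.
    by rewrite /ecol /= !qE !tailE.
  rewrite !nth_zipcat ?sizes // !(nth_sg _ i0) ?sE1 ?sE2 //.
  rewrite (nth_vl E1) ?sE1 // (nth_vl E2) ?sE2 // nth_vr //.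
  have ge_s : 3 * k <= nth j0 D t by apply: geD; rewrite mem_nth.
  have [lt_e1 lt_e2] : nth i0 E1 t < 2 * k /\ nth i0 E2 t < 2 * k.
    by split; apply: lt0; rewrite !mem_cat mem_nth ?orbT ?sE1 ?sE2.
  move: (nth i0 E1 t) (nth i0 E2 t) (nth j0 D t) lt_e1 lt_e2 ge_s => e1 e2 s lt_e1 lt_e2 ge_s.
  have sE (i : 'I_m) : i < 2 * k -> col i s = kap i :> nat.
    by move=> lt_i; rewrite colE /six_colour ltnNge ge_s lt_i.
  rewrite /=; split=> // -[] // y lt_y.
  by rewrite /ecol /= !qE !tailE // !sE.
have [s Es] : exists s, s = flatten X by eexists.
have := flatten_good_cycle (etrans sizeX (esym sizeK)) good; rewrite -Es.
have size_s : 2 < size s.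
  by rewrite Es (perm_size permX) size_cat !size_map !size_cat sQ sR1 sR2; lia.
rewrite -Es in UX permX; exists s; split; last exact: perm_mem permX.
case: s {permX Es} UX size_s H => // x p Up size_p [path_p col_p].
by rewrite rainbow_consE size_p Up path_p col_p.
Qed.

(** The vertices of [S] are distributed over the blocks: those of [Se] are inserted between vertices
    of [E], while [P], [Q] and [R] complete the left vertices of either kind and the core vertices
    of [S] to the sizes needed for [k] blocks. *)
Lemma crx_upper_6k (k m n : nat) :
  0 < k -> 3 * k <= m -> 3 * k <= n -> crx_feasible k m n (6 * k).
Proof.
move=> k_gt0 le_m le_n.
have [i j _ _|col colE] := @colouring_of_nat m n (6 * k) (six_colour k).
  exact: six_colour_lt.
exists col => S cardS.
pose SL := [set i : 'I_m | inl i \in S]; pose SR := [set j : 'I_n | inr j \in S].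
have cardSLR : #|SL| + #|SR| = k.
  have inl_inj: injective (inl : 'I_m -> Kvert m n) by move=> ? ? [].
  have inr_inj: injective (inr : 'I_n -> Kvert m n) by move=> ? ? [].
  rewrite -(card_imset _ inl_inj) -(card_imset _ inr_inj) -cardS.
  rewrite -(cardsID [set x | left_class x] S); congr (_ + _); apply: eq_card => x.
    rewrite !inE; apply/imsetP/andP => [[i + ->]|[]]; first by rewrite inE.
    by case: x => // i iS _; exists i; rewrite ?inE.
  rewrite !inE; apply/imsetP/andP => [[j + ->]|[]]; first by rewrite inE.
  by case: x => // j _ jS; exists j; rewrite ?inE.
pose L0 := [set i : 'I_m | i < 2 * k]; pose C := [set j : 'I_n | j < 3 * k].
have cardL0 : #|L0| = 2 * k by rewrite card_ord_lt //; lia.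
have cardC : #|C| = 3 * k by rewrite card_ord_lt.
pose Sc := SR :&: C; pose Se := SR :\: C.
have cardS4 : #|SL :&: L0| + #|SL :\: L0| + (#|Sc| + #|Se|) = k.
  by rewrite !cardsID.
(* Edges leaving the core from such an [i] could clash with those at the core vertex of index
   [i./2], which must be visited. Each index comes from at most two values of [i]. *)
pose bad := [set i in L0 | [exists j in Sc, i./2 == j]].
have card_bad : #|bad| <= 2 * #|Sc|.
  have i0 : 'I_m by apply: (@Ordinal m 0); lia.
  pose h (p : 'I_n * bool) : 'I_m := insubd i0 (p.2 + p.1.*2).
  rewrite -card_bool -cardsT mulnC -cardsX.
  apply: leq_trans (leq_imset_card h _); apply/subset_leq_card/subsetP => i.
  rewrite inE => /andP[_ /exists_inP[j jS /eqP eq_ij]]; apply/imsetP.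
  exists (j, odd i); first by rewrite inE /= jS inE.
  by rewrite /h /= -eq_ij odd_double_half valKd.
have [E [_ sE card_E]] : exists E : {set 'I_m},
    [/\ set0 \subset E, E \subset L0 :\: (SL :|: bad) & #|E| = 2 * #|Se|].
  apply: exists_set_between; rewrite ?sub0set // cards0 /=.
  rewrite (cardsD L0) cardL0.
  (* Excluding [SL] and [bad] from the [2 * k] vertices of [L0] leaves at least [2 * #|Se|], by
     [cardS4]. *)
  have arith a0 a1 b d e x : a0 + a1 + (b + d) = k -> e <= 2 * b -> x <= a0 + e ->
    2 * d <= 2 * k - x by lia.
  apply: arith cardS4 card_bad _.
  apply: leq_trans (leq_card_setU _ _); apply/subset_leq_card/subsetP => i.
  by rewrite !inE => /andP[-> /orP[->|->]]; rewrite ?orbT.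
(* Core indices blocked by the colours at [E]. At most [k] core vertices are lost, so [2 * k] of the
   [3 * k] remain for [R]. *)
pose H := [set j : 'I_n | [exists i in E, i./2 == j]].
have sEL0 : E \subset L0 by apply: subset_trans sE (subsetDl _ _).
(* Since [#|Se|] blocks start in [E], the heads of the remaining ones come from [P]. *)
have [P [sP sPL cardP]] : exists P : {set 'I_m},
    [/\ SL :&: L0 \subset P, P \subset L0 :\: E & #|P| = k - #|Se|].
  apply: exists_set_between.
    apply/subsetP=> i; rewrite !inE => /andP[iS iL]; rewrite iL andbT.
    by apply/negP=> /(subsetP sE); rewrite !inE iS.
  rewrite (cardsD L0 E) (setIidPr sEL0) cardL0 card_E.
  have arith a0 a1 b d : a0 + a1 + (b + d) = k -> a0 <= k - d <= 2 * k - 2 * d by lia.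
  exact: arith cardS4.
have [Q [sQ sQL cardQ]] : exists Q : {set 'I_m},
    [/\ SL :\: L0 \subset Q, Q \subset ~: L0 & #|Q| = k].
  apply: exists_set_between.
    by apply/subsetP=> i; rewrite !inE => /andP[].
  have arith a0 a1 b d x : a0 + a1 + (b + d) = k -> 2 * k + x = m -> a1 <= k <= x by lia.
  by apply: arith cardS4 _; rewrite -cardL0 cardsC card_ord.
have card_H : #|C :&: H| <= k.
  rewrite -[leqRHS](@card_ord_lt n) ?subset_leq_card //; last by lia.
  apply/subsetP=> j; rewrite !inE => /andP[_ /exists_inP[i iE /eqP <-]].
  by have := subsetP sEL0 _ iE; rewrite inE mul2n -ltn_half_double.
have [R [sR sRC cardR]] : exists R : {set 'I_n},
    [/\ Sc \subset R, R \subset C :\: H & #|R| = 2 * k].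
  apply: exists_set_between.
    apply/subsetP=> j jS; rewrite !inE; move: (jS); rewrite !inE => /andP[_ ->].
    rewrite andbT; apply/negP => /exists_inP[i iE eq_ij].
    have := subsetP sE _ iE; rewrite !inE => /andP[/norP[_ /negP nbad] lt_i].
    by apply: nbad; rewrite lt_i; apply/exists_inP; exists j.
  rewrite (cardsD C H) cardC.
  have arith a0 a1 b d x : a0 + a1 + (b + d) = k -> x <= k -> b <= 2 * k <= 3 * k - x by lia.
  exact: arith cardS4 card_H.
have sz (T : finType) (A : {set T}) : size (enum A) = #|A| by rewrite -cardE.
have [s [rb_s mem_s]] : exists s, rainbow_cycle col s /\
  s =i [seq (inl i : Kvert m n) | i <- take #|Se| (enum E) ++ drop #|Se| (enum E) ++ enum P ++ enum Q]
    ++ [seq (inr j : Kvert m n) | j <- enum Se ++ take k (enum R) ++ drop k (enum R)].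
  have memE : take #|Se| (enum E) ++ drop #|Se| (enum E) = enum E by apply: cat_take_drop.
  have memR : take k (enum R) ++ drop k (enum R) = enum R by apply: cat_take_drop.
  apply: six_colour_cycle colE _ _ _ _ _ _ _ _ _ _ _ _ _ _ _ _ => //.
  - by rewrite size_takel !sz // card_E leq_pmull.
  - by rewrite size_drop !sz card_E mul2n -addnn addnK.
  - by rewrite !sz cardP subnKC // -[leqRHS]cardS4 addnA leq_addl.
  - by rewrite sz.
  - by rewrite size_takel // sz cardR leq_pmull.
  - by rewrite size_drop sz cardR mul2n -addnn addnK.
  - rewrite catA memE cat_uniq !enum_uniq andbT /=; apply/hasPn => i.
    by rewrite !mem_enum => /(subsetP sPL); rewrite inE => /andP[].
  - move=> i; rewrite catA memE mem_cat !mem_enum => /orP[/(subsetP sEL0)|/(subsetP sPL)].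
      by rewrite inE.
    by rewrite !inE => /andP[].
  - exact: enum_uniq.
  - by move=> i; rewrite mem_enum => /(subsetP sQL); rewrite !inE -leqNgt.
  - by rewrite memR enum_uniq.
  - by move=> j; rewrite memR mem_enum => /(subsetP sRC); rewrite !inE => /andP[].
  - exact: enum_uniq.
  - by move=> j; rewrite mem_enum !inE -leqNgt => /andP[].
  - move=> i j; rewrite memE memR !mem_enum => iE /(subsetP sRC).
    rewrite !inE => /andP[jH _]; apply: contraNneq jH => eq_ij.
    by apply/exists_inP; exists i => //; apply/eqP.
exists s; split=> // x xS; rewrite mem_s mem_cat cat_take_drop catA cat_take_drop.
case: x xS => [i|j] xS; apply/orP; [left|right]; apply: map_f.
  rewrite !mem_cat !mem_enum; have [lt_i|ge_i] := ltnP i (2 * k).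
    by rewrite (subsetP sP) ?orbT // !inE xS.
  by rewrite (subsetP sQ) ?orbT // !inE xS -leqNgt ge_i.
rewrite mem_cat !mem_enum; have [lt_j|ge_j] := ltnP j (3 * k).
  by rewrite (subsetP sR) ?orbT // !inE xS.
by rewrite !inE xS -leqNgt ge_j.
Qed.

Theorem theorem3p3 :
  (* (a) *)
  (forall m n : nat, 2 <= m -> m <= n -> crx_is 1 m n 4) /\
  (* (b)(i) *)
  (forall n : nat, 2 <= n -> crx_is 2 2 n (2 * n)) /\
  (* (b)(ii) *)
  (forall n r : nat, 36 <= n -> 'C(r.-1, 3) < n <= 'C(r, 3) ->
     crx_is 2 3 n r /\
     Rlt (INR 1) (Rminus (INR r) (Rpower (INR (6 * n)) (Rinv (INR 3)))) /\
     Rlt (Rminus (INR r) (Rpower (INR (6 * n)) (Rinv (INR 3)))) (INR 3)) /\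
  (* (b)(iii) *)
  (forall m n : nat, 4 <= m -> 7 ^ m < n -> crx_is 2 m n 8) /\
  (* (c) *)
  (forall k : nat, 2 <= k ->
     (* (i) *)
     (forall n : nat, k <= n ->
        (forall c, crx_feasible k k n c -> (n + (k - 1) - 1) %/ (k - 1) <= c) /\
        crx_feasible k k n (k * n)) /\
     (* (ii) *)
     (forall m n : nat, 2 * k <= m -> (k - 1) * (4 * k - 1) ^ m < n ->
        forall c, crx_feasible k m n c -> 4 * k <= c) /\
     (* (iii) *)
     (forall m n : nat, 3 * k <= m -> m <= n -> crx_feasible k m n (6 * k))).
Proof.
have twins k m n : 2 <= k -> (k - 1) * (4 * k - 1) ^ m < n ->
    forall c, crx_feasible k m n c -> 4 * k <= c.
  (* If [c < 4 * k], there are at most [(4 * k - 1) ^ m] colour vectors, so [feasible_twins] applies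
     and gives a contradiction. *)
  move=> k_ge2 lt_n c feas; rewrite leqNgt; apply/negP => lt_c.
  have: 4 * k <= c; last by rewrite leqNgt lt_c.
  apply: feasible_twins feas; apply: leq_ltn_trans lt_n.
  have le_exp p a b : a <= b -> a ^ p <= b ^ p by case: p => // p; rewrite leq_exp2r.
  by rewrite -subn1 leq_mul2l le_exp ?orbT //; lia.
split=> [m n m_ge2 le_mn|].
  split; first by apply: crx1_upper => //; apply: leq_trans le_mn.
  by move=> c; apply: feasible_size; rewrite /= addn_gt0 (ltnW m_ge2).
split=> [n n_ge2|].
  (* The upper bound is the case [k = 2] of [k * n]. *)
  by split=> [|c]; [exact: crx_Kkn_upper | exact: crx2_K2n_lower].
split=> [n r n_ge bin_n|].
  have /andP[lo hi] := bin_n; have r_ge := bin3_ge8 n_ge hi.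
  split; last exact: cbrt_bounds.
  split; first by apply: crx2_K3n_upper; [rewrite n_ge | exact: ltnW].
  move=> c /crx2_K3n_lower n_le; rewrite leqNgt; apply/negP => lt_cr.
  have le_c : c <= r.-1 by lia.
  have := leq_ltn_trans (leq_bin2l 3 le_c) lo; rewrite ltnNge n_le //.
  exact: leq_trans n_ge.
split=> [m n m_ge4 n_gt|k k_ge2].
  (* Here [4 * 2 - 1 = 7]. *)
  split; last by move=> c; apply: (twins 2) => //; rewrite mul1n.
  by apply: crx2_eight_colours => //; apply: leq_trans (double_le_exp7 m) (ltnW n_gt).
split=> [n le_kn|].
  split=> [c feas|]; last by apply: crx_Kkn_upper; rewrite k_ge2.
  (* The quotient in the goal is the ceiling of [n / (k - 1)], so [n <= (k - 1) * c] suffices. *)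
  have := feasible_Kkn (ltnW k_ge2) feas; rewrite -subn1 => le_n.
  rewrite -ltnS ltn_divLR; lia.
split=> [m n _|m n le_m le_mn]; first exact: twins.
by apply: crx_upper_6k => //; [exact: ltnW | exact: leq_trans le_mn].
Qed.
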